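(* For every formula $\varphi \in \mathcal{L}_{\Box\Diamond}(V)$: $\vdash_{\mathcal{GK}^c} \varphi$ if and only if $\models_{\mathbf{GK}^c} \varphi$.
   Context: $V$ is a countable set of propositional variables. $\mathcal{L}_{\Box\Diamond}(V)$ is the set of formulas built from $V$ and the constant $\bot$ with binary connectives $\wedge,\vee,\rightarrow$ and unary modalities $\Box,\Diamond$; $\top := \bot\rightarrow\bot$, $\neg\varphi := \varphi\rightarrow\bot$. The standard Gödel algebra $[0,1]_G$ has $\wedge=\min$, $\vee=\max$, constant $0$, and $a\rightarrow b = 1$ if $a\le b$, $=b$ otherwise. A crisp Gödel–Kripke model is $\langle W,R,e\rangle$ with $W\neq\emptyset$, $R\subseteq W\times W$, $e: V\times W\to[0,1]$; $e$ extends to all formulas by $e(v,\bot)=0$, $e(v,\varphi\star\psi)=e(v,\varphi)\star e(v,\psi)$ for $\star\in\{\wedge,\vee,\rightarrow\}$ computed in $[0,1]_G$, $e(v,\Box\varphi)=\inf\{e(w,\varphi): Rvw\}$ (with $\inf\emptyset=1$), $e(v,\Diamond\varphi)=\sup\{e(w,\varphi): Rvw\}$ (with $\sup\emptyset=0$). $\models_{\mathbf{GK}^c}\varphi$ means $e(v,\varphi)=1$ for every crisp Gödel–Kripke model and every world $v$. The axiomatic system $\mathcal{GK}^c$ consists of: the Hilbert calculus of Gödel–Dummett propositional logic $\mathcal{G}$ (intuitionistic propositional calculus plus the prelinearity axiom $(\varphi\to\psi)\vee(\psi\to\varphi)$, with modus ponens) applied to all formulas of $\mathcal{L}_{\Box\Diamond}(V)$;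 the axiom schemes $(K_\Box)\ \Box(\varphi\to\psi)\to(\Box\varphi\to\Box\psi)$, $(K_\Diamond)\ \Diamond(\varphi\vee\psi)\to(\Diamond\varphi\vee\Diamond\psi)$, $(FS1)\ \Diamond(\varphi\to\psi)\to(\Box\varphi\to\Diamond\psi)$, $(FS2)\ (\Diamond\varphi\to\Box\psi)\to\Box(\varphi\to\psi)$, $(F_\Diamond)\ \neg\Diamond\bot$, $(Cr)\ \Box(\varphi\vee\psi)\to(\Box\varphi\vee\Diamond\psi)$; and the rules $(N_\Box)$: from a theorem $\varphi$ infer $\Box\varphi$, $(N_\Diamond)$: from a theorem $\varphi\to\psi$ infer $\Diamond\varphi\to\Diamond\psi$ (these two rules apply only to theorems, i.e. formulas derivable from the empty set). $\Gamma\vdash_{\mathcal{GK}^c}\varphi$ means $\varphi$ is derivable from premises $\Gamma$ using axioms, modus ponens and these rules; $\vdash_{\mathcal{GK}^c}\varphi$ means $\emptyset\vdash_{\mathcal{GK}^c}\varphi$. *)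

(* Defs.v *)
From mathcomp Require Import all_boot all_order all_algebra.
From mathcomp Require Import boolp classical_sets reals.

Set Implicit Arguments.
Unset Strict Implicit.
Unset Printing Implicit Defensive.

Import Order.TTheory GRing.Theory Num.Theory.
Local Open Scope classical_set_scope.
Local Open Scope ring_scope.

Inductive fml (V : Type) : Type :=
| Var of V
| Bot
| And of fml V & fml V
| Or of fml V & fml V
| Imp of fml V & fml V
| Box of fml V
| Dia of fml V.

Arguments Bot {V}.

Definition Neg (V : Type) (p : fml V) : fml V := Imp p Bot.

Inductive GKc_axiom (V : Type) : fml V -> Prop :=
| ax_K p q : GKc_axiom (Imp p (Imp q p))
| ax_S p q r :
    GKc_axiom (Imp (Imp p (Imp q r)) (Imp (Imp p q) (Imp p r)))
| ax_andl p q : GKc_axiom (Imp (And p q) p)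
| ax_andr p q : GKc_axiom (Imp (And p q) q)
| ax_and p q : GKc_axiom (Imp p (Imp q (And p q)))
| ax_orl p q : GKc_axiom (Imp p (Or p q))
| ax_orr p q : GKc_axiom (Imp q (Or p q))
| ax_or p q r :
    GKc_axiom (Imp (Imp p r) (Imp (Imp q r) (Imp (Or p q) r)))
| ax_bot p : GKc_axiom (Imp Bot p)
| ax_prelin p q : GKc_axiom (Or (Imp p q) (Imp q p))
| ax_KBox p q : GKc_axiom (Imp (Box (Imp p q)) (Imp (Box p) (Box q)))
| ax_KDia p q : GKc_axiom (Imp (Dia (Or p q)) (Or (Dia p) (Dia q)))
| ax_FS1 p q : GKc_axiom (Imp (Dia (Imp p q)) (Imp (Box p) (Dia q)))
| ax_FS2 p q : GKc_axiom (Imp (Imp (Dia p) (Box q)) (Box (Imp p q)))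
| ax_FDia : GKc_axiom (Neg (Dia Bot))
| ax_Cr p q : GKc_axiom (Imp (Box (Or p q)) (Or (Box p) (Dia q))).

(* The premises of the two modal rules must be derivable from the empty set,
   whatever the current set of premises is. *)
Inductive derives (V : Type) : set (fml V) -> fml V -> Prop :=
| d_prem G p : G p -> derives G p
| d_ax G p : GKc_axiom p -> derives G p
| d_MP G p q : derives G (Imp p q) -> derives G p -> derives G q
| d_NBox G p : derives set0 p -> derives G (Box p)
| d_NDia G p q : derives set0 (Imp p q) -> derives G (Imp (Dia p) (Dia q)).

Definition provable (V : Type) (p : fml V) : Prop := derives set0 p.

Definition gimp (R : realType) (a b : R) : R := if a <= b then 1 else b.

(* Infimum and supremum of a subset of [0, 1], as a complete lattice: the
   library has inf set0 = sup set0 = 0, whereas the infimum of the empty set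
   in [0, 1] is 1. *)
Definition ginf (R : realType) (A : set R) : R :=
  if `[< A = set0 >] then 1 else inf A.

Definition gsup (R : realType) (A : set R) : R :=
  if `[< A = set0 >] then 0 else sup A.

Record model (R : realType) (V : Type) : Type := Model {
  world : Type;
  world_inhabited : inhabited world;
  acc : world -> world -> Prop;
  val_of : world -> V -> R;
  val_of_itv : forall v x, 0 <= val_of v x <= 1
}.

Fixpoint feval (R : realType) (V : Type) (M : model R V) (v : world M)
    (p : fml V) : R :=
  match p with
  | Var x => val_of v x
  | Bot => 0
  | And q r => Num.min (feval v q) (feval v r)
  | Or q r => Num.max (feval v q) (feval v r)
  | Imp q r => gimp (feval v q) (feval v r)
  | Box q => ginf [set a | exists2 w, acc v w & a = feval w q]
  | Dia q => gsup [set a | exists2 w, acc v w & a = feval w q]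
  end.

Definition valid (R : realType) (V : Type) (p : fml V) : Prop :=
  forall (M : model R V) (v : world M), feval v p = 1.

(* Main.v *)
Require Import Defs.
From HB Require Import structures.
From mathcomp Require Import all_boot all_order all_algebra.
From mathcomp Require Import boolp classical_sets reals.
From mathcomp Require Import lra.

(* Completeness. Fix a finite set S of formulas closed under subformulas. The
   worlds of the canonical model are the valuations h : fml V -> R that realise
   on S the linear order "p -> q in P" of some prime theory P; g is a successor
   of h when h []p <= g p <= h <>p on S. Given P and h, a prime theory Q
   with {p | []p in P} <= Q <= {p | <>p in P} (it exists by Cr) satisfies, by
   FS1 and FS2, exactly the inequalities that allow its chain to be placed in
   [0,1] between l p = max {h []a | a <=_Q p} and u p = min {h <>b | p <=_Q b}.
   The placement is free inside these intervals, so it can be pushed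
   arbitrarily close to l or to u: infima and suprema are approached but need
   not be attained, as the logic lacks finite models. Finiteness of S makes l
   and u attained and gives the rank that breaks ties. *)

Set Implicit Arguments.
Unset Strict Implicit.
Unset Printing Implicit Defensive.

Import Order.TTheory GRing.Theory Num.Theory.
Local Open Scope classical_set_scope.
Local Open Scope ring_scope.

HB.instance Definition _ (V : Type) := gen_eqMixin (fml V).

(** * Theories of the calculus and derived rules *)

Section Theories.
Variable V : Type.
Implicit Types (p q r s : fml V) (T P Q A : set (fml V)).

(** Closure under the modal rules is not asked, as these act on theorems only; so the consequences
    of a hypothesis and the formulas boxed in [T] again form theories. *)
Record theory T : Prop := Theory {
  th_provable : forall p, provable p -> T p;
  th_mp : forall p q, T (Imp p q) -> T p -> T q }.

Lemma provable_theory : theory (@provable V).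
Proof. by split=> // p q; apply: d_MP. Qed.

Section TheoryRules.
Variables (T : set (fml V)) (thT : theory T).

Lemma th_ax p : GKc_axiom p -> T p.
Proof. by move=> ax; apply: (th_provable thT); apply: d_ax. Qed.

Lemma th_const p q : T q -> T (Imp p q).
Proof. by apply: th_mp => //; apply: th_ax; constructor. Qed.

Lemma th_S p q r : T (Imp p (Imp q r)) -> T (Imp p q) -> T (Imp p r).
Proof.
move=> pqr; apply: th_mp => //; apply: th_mp pqr => //.
by apply: th_ax; constructor.
Qed.

Lemma th_refl p : T (Imp p p).
Proof. by apply: (@th_S _ (Imp p p)); apply: th_ax; constructor. Qed.

Lemma th_trans q p r : T (Imp p q) -> T (Imp q r) -> T (Imp p r).
Proof. by move=> pq qr; apply: th_S pq; apply: th_const. Qed.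

(** Plays the role of the deduction theorem: reasoning under hypotheses becomes reasoning in a
    theory, and nesting adds further hypotheses. *)
Lemma theory_imp p : theory (fun q => T (Imp p q)).
Proof.
split=> [q Tq|q r]; last exact: th_S.
by apply: th_const; apply: th_provable.
Qed.

Lemma th_andP p q : T (And p q) <-> T p /\ T q.
Proof.
split=> [pq|[Tp]].
  by split; apply: th_mp pq => //; apply: th_ax; constructor.
by apply: th_mp => //; apply: th_mp Tp => //; apply: th_ax; constructor.
Qed.

Lemma th_imp_and p q r : T (Imp r p) -> T (Imp r q) -> T (Imp r (And p q)).
Proof.
move=> rp; apply: th_S; apply: th_trans rp _.
by apply: th_ax; constructor.
Qed.

Lemma th_andl p q : T (Imp (And p q) p).
Proof. by apply: th_ax; constructor. Qed.

Lemma th_andr p q : T (Imp (And p q) q).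
Proof. by apply: th_ax; constructor. Qed.

Lemma th_orl p q : T (Imp p (Or p q)).
Proof. by apply: th_ax; constructor. Qed.

Lemma th_orr p q : T (Imp q (Or p q)).
Proof. by apply: th_ax; constructor. Qed.

Lemma th_or_imp p q r : T (Imp p r) -> T (Imp q r) -> T (Imp (Or p q) r).
Proof.
move=> pr; apply: th_mp => //; apply: th_mp pr => //.
by apply: th_ax; constructor.
Qed.

Lemma th_bot p : T (Imp Bot p).
Proof. by apply: th_ax; constructor. Qed.

Lemma th_prelin p q : T (Or (Imp p q) (Imp q p)).
Proof. by apply: th_ax; constructor. Qed.

Lemma th_box p : provable p -> T (Box p).
Proof. by move=> ?; apply: (th_provable thT); apply: d_NBox. Qed.

Lemma th_dia p q : provable (Imp p q) -> T (Imp (Dia p) (Dia q)).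
Proof. by move=> ?; apply: (th_provable thT); apply: d_NDia. Qed.

Lemma th_KBox p q : T (Box (Imp p q)) -> T (Imp (Box p) (Box q)).
Proof. by apply: th_mp => //; apply: th_ax; constructor. Qed.

Lemma th_FS1 p q : T (Dia (Imp p q)) -> T (Imp (Box p) (Dia q)).
Proof. by apply: th_mp => //; apply: th_ax; constructor. Qed.

Lemma th_FS2 p q : T (Imp (Dia p) (Box q)) -> T (Box (Imp p q)).
Proof. by apply: th_mp => //; apply: th_ax; constructor. Qed.

Lemma th_KDia p q : T (Imp (Dia (Or p q)) (Or (Dia p) (Dia q))).
Proof. by apply: th_ax; constructor. Qed.

Lemma th_Cr p q : T (Box (Or p q)) -> T (Or (Box p) (Dia q)).
Proof. by apply: th_mp => //; apply: th_ax; constructor. Qed.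

Lemma th_DiaBot p : T (Imp (Dia Bot) p).
Proof. by apply: th_trans (th_bot p); apply: th_ax; constructor. Qed.

Lemma th_BoxTop : T (Box (Imp Bot Bot)).
Proof. by apply: th_box; apply: d_ax; constructor. Qed.

Lemma theory_box : theory (fun p => T (Box p)).
Proof.
split=> [|p q bpq]; first exact: th_box.
by apply: th_mp => //; apply: th_KBox.
Qed.

End TheoryRules.

(** The formulas whose box follows from [r] form a theory, hence are closed under conjunction. *)
Lemma th_box_and T p q r : theory T ->
  T (Imp r (Box p)) -> T (Imp r (Box q)) -> T (Imp r (Box (And p q))).
Proof.
move=> thT rp rq.
by apply: (proj2 (th_andP (theory_box (theory_imp thT r)) p q)).
Qed.

(* Apply FS1 to the monotone image <>p -> <>((p -> q) -> q). *)
Lemma th_box_dia T p q : theory T ->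
  T (Box (Imp p q)) -> T (Imp (Dia p) (Dia q)).
Proof.
move=> thT bpq.
have mp : provable (Imp p (Imp (Imp p q) q)).
  have thp := theory_imp provable_theory p.
  have thpq := theory_imp thp (Imp p q).
  apply: (th_mp thpq (p := p)); first exact: (th_refl thp).
  by apply: (th_const thp); apply: (th_refl provable_theory).
apply: (th_S thT (q := Box (Imp p q))); last exact: th_const.
apply: (th_trans thT (th_dia thT mp)).
by apply: (th_ax thT); constructor.
Qed.

(** * Prime theories and their linear order *)

Record prime P : Prop := Prime {
  pr_theory : theory P;
  pr_bot : ~ P Bot;
  pr_or : forall p q, P (Or p q) -> P p \/ P q }.

Section PrimeRules.
Variables (P : set (fml V)) (prP : prime P).
Let thP := pr_theory prP.

Lemma pr_total p q : P (Imp p q) \/ P (Imp q p).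
Proof. by apply: (pr_or prP); apply: th_prelin. Qed.

Lemma pr_notimp p q : ~ P (Imp p q) -> P (Imp q p).
Proof. by case: (pr_total p q). Qed.

(** By prelinearity one disjunct implies the other in [P], so the disjunction is the maximum of a
    chain. *)
Lemma pr_imp_or p q r : P (Imp r (Or p q)) -> P (Imp r p) \/ P (Imp r q).
Proof.
move=> rpq; case: (pr_total p q) => [pq|qp]; [right|left];
  by apply: (th_trans thP rpq); apply: th_or_imp => //; apply: th_refl.
Qed.

Lemma pr_and_imp p q r : P (Imp (And p q) r) -> P (Imp p r) \/ P (Imp q r).
Proof.
move=> pqr; case: (pr_total p q) => [pq|qp]; [left|right];
  by apply: (th_trans thP) pqr; apply: th_imp_and => //; apply: th_refl.
Qed.

(** Compare [Imp p q] with [p]: if it lies below [p], contraction gives the claim; if above,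
    contraction gives [Imp p q], which is excluded. *)
Lemma pr_imp_collapse p q : ~ P (Imp p q) -> P (Imp (Imp p q) q).
Proof.
move=> npq; case: (pr_total (Imp p q) p) => [pqp|ppq].
  exact: (th_S thP (th_refl thP _) pqp).
by case: npq; apply: (th_S thP) ppq (th_refl thP _).
Qed.

End PrimeRules.

(** * Prime extensions and modal successors *)

Definition directed A :=
  forall p q, A p -> A q ->
    exists r, [/\ A r, provable (Imp p r) & provable (Imp q r)].

(** Take a maximal theory avoiding [A]. Directedness replaces closure of [A] under disjunction, and
    an element of [A] keeps [Bot] out. *)
Lemma prime_extension T A : theory T -> directed A -> A !=set0 ->
    (forall p, A p -> ~ T p) ->
  exists Q, [/\ prime Q, T `<=` Q & forall p, A p -> ~ Q p].
Proof.
move=> thT dirA [a Aa] AT.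
(* T is adjoined to X because Zorn_bigcup also asks for the empty chain. *)
pose ok X := theory (T `|` X) /\ forall p, A p -> ~ (T `|` X) p.
have [|Q [[thQ AQ] maxQ]] := @Zorn_bigcup _ ok.
  move=> F okF totF; split; last first.
    by move=> p Ap [/(AT _ Ap)|[X /okF[_ AX] Xp]] //; apply: (AX _ Ap); right.
  split=> [p pp|p q]; first by left; exact: th_provable.
  move=> [Tpq|[X FX Xpq]] [Tp|[Y FY Yp]].
  - by left; apply: th_mp Tpq Tp.
  - have [thY _] := okF _ FY.
    by case: (th_mp thY (or_introl Tpq) (or_intror Yp)); [left|right; exists Y].
  - have [thX _] := okF _ FX.
    by case: (th_mp thX (or_intror Xpq) (or_introl Tp)); [left|right; exists X].
  - have [thX _] := okF _ FX; have [thY _] := okF _ FY.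
    case: (totF _ _ FX FY) => [/(_ _ Xpq) Ypq|/(_ _ Yp) Xp].
      by case: (th_mp thY (or_intror Ypq) (or_intror Yp));
        [left|right; exists Y].
    by case: (th_mp thX (or_intror Xpq) (or_intror Xp)); [left|right; exists X].
exists (T `|` Q); split; [|by left|by []].
(* The consequences of an omitted [p] form a strictly larger theory, which by maximality meets
   [A]. *)
have ext p : ~ (T `|` Q) p -> exists2 r, A r & (T `|` Q) (Imp p r).
  move=> np; apply: contrapT => nex.
  pose B := [set q | (T `|` Q) (Imp p q)].
  have TQB : T `|` Q `<=` B by move=> q; apply: th_const.
  have TB : T `|` B = B.
    by apply/seteqP; split=> [q [Tq|//]|q]; [apply: TQB; left|right].
  apply: (maxQ B).
    split; first by move=> q Qq; apply: TQB; right.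
    by move=> BQ; apply: np; right; apply: BQ; apply: th_refl.
  split; first by rewrite TB; apply: theory_imp.
  by rewrite TB => r Ar pr; apply: nex; exists r.
split=> // [bot|p q pq].
  by apply: (AQ _ Aa); apply: th_mp bot => //; apply: th_bot.
apply: contrapT => /not_orP[/ext[r Ar pr] /ext[s As qs]].
have [t [At rt st]] := dirA _ _ Ar As.
apply: (AQ _ At); apply: th_mp pq => //.
apply: th_or_imp => //.
  by apply: (th_trans thQ pr); apply: th_provable.
by apply: (th_trans thQ qs); apply: th_provable.
Qed.

Lemma prime_successor P A : prime P -> directed A -> A !=set0 ->
    (forall p, A p -> ~ P (Box p)) ->
  exists Q, [/\ prime Q, forall p, P (Box p) -> Q p,
    forall p, Q p -> P (Dia p) & forall p, A p -> ~ Q p].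
Proof.
move=> prP dirA [a Aa] AP; have thP := pr_theory prP.
have thpr := provable_theory.
(* Avoiding A \/ r for all r with <>r outside P; by Cr, [](q \/ r) in P would
   put []q or <>r in P. *)
pose B := [set p | exists q r, [/\ A q, ~ P (Dia r) & p = Or q r]].
(* Thus [Bot] is an admissible [r]: it makes [B] nonempty, and avoiding [B] then entails avoiding
   [A]. *)
have nbot : ~ P (Dia Bot) by move/(th_mp thP (th_DiaBot thP Bot))/(pr_bot prP).
have [| | |Q [prQ PQ BQ]] := @prime_extension _ B (theory_box thP).
- move=> _ _ [q [r [Aq nr ->]]] [q' [r' [Aq' nr' ->]]].
  have [s [As qs qs']] := dirA _ _ Aq Aq'.
  exists (Or s (Or r r')); split.
  + exists s, (Or r r'); split=> // /(th_mp thP (th_KDia thP _ _)).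
    by case/(pr_or prP).
  + apply: th_or_imp => //; first exact: (th_trans thpr qs (th_orl thpr _ _)).
    exact: (th_trans thpr (th_orl thpr _ r') (th_orr thpr _ _)).
  + apply: th_or_imp => //; first exact: (th_trans thpr qs' (th_orl thpr _ _)).
    exact: (th_trans thpr (th_orr thpr r _) (th_orr thpr _ _)).
- by exists (Or a Bot), a, Bot.
- move=> _ [q [r [Aq nr ->]]] /(th_Cr thP)/(pr_or prP)[|//].
  exact: AP.
have thQ := pr_theory prQ.
exists Q; split=> // [p Qp|p Ap Qp].
  apply: contrapT => np; apply: (BQ (Or a p)); first by exists a, p.
  exact: th_mp (th_orr thQ _ _) Qp.
apply: (BQ (Or p Bot)); first by exists p, Bot.
exact: th_mp (th_orl thQ _ _) Qp.
Qed.

(** The last clause keeps the lower end of the interval of [p] at or below the value of [Box p]. To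
    get it, all offending [Imp q p] are avoided at once; they are directed since boxes commute with
    conjunction and [P] is linear. *)
Lemma prime_box_successor P p : prime P -> ~ P (Box p) ->
  exists Q, [/\ prime Q, forall q, P (Box q) -> Q q,
    forall q, Q q -> P (Dia q) &
    forall q, Q (Imp q p) -> P (Imp (Box q) (Box p))].
Proof.
move=> prP np; have thP := pr_theory prP; have thpr := provable_theory.
pose A := [set r | exists2 q, ~ P (Imp (Box q) (Box p)) & r = Imp q p].
have [| | |Q [prQ PQ QP AQ]] := @prime_successor P A prP.
- move=> _ _ [q nq ->] [q' nq' ->].
  exists (Imp (And q q') p); split.
  + exists (And q q') => // bqq'.
    have : P (Imp (And (Box q) (Box q')) (Box p)).
      apply: (th_trans thP) bqq'.
      by apply: th_box_and => //; [apply: th_andl|apply: th_andr].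
    by case/(pr_and_imp prP).
  + have th := theory_imp thpr (Imp q p).
    apply: (th_trans th (th_andl th q q')); exact: th_refl.
  + have th := theory_imp thpr (Imp q' p).
    apply: (th_trans th (th_andr th q q')); exact: th_refl.
- exists (Imp (Imp Bot Bot) p), (Imp Bot Bot) => // bp; apply: np.
  by apply: (th_mp thP bp); apply: th_BoxTop.
- by move=> _ [q nq ->] /(th_KBox thP).
exists Q; split=> // q qp; apply: contrapT => nq.
by apply: AQ qp; exists q.
Qed.

(** Dual construction: [K_Dia] gives directedness, [th_box_dia] keeps the avoided formulas out of
    the boxed part of [P], and the hypothesis makes [Imp p Bot] one of them. *)
Lemma prime_dia_successor P p : prime P -> ~ P (Imp (Dia p) (Dia Bot)) ->
  exists Q, [/\ prime Q, forall q, P (Box q) -> Q q,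
    forall q, Q q -> P (Dia q) &
    forall q, Q (Imp p q) -> P (Imp (Dia p) (Dia q))].
Proof.
move=> prP np; have thP := pr_theory prP; have thpr := provable_theory.
pose A := [set r | exists2 q, ~ P (Imp (Dia p) (Dia q)) & r = Imp p q].
have [| | |Q [prQ PQ QP AQ]] := @prime_successor P A prP.
- move=> _ _ [q nq ->] [q' nq' ->].
  exists (Imp p (Or q q')); split.
  + exists (Or q q') => // dqq'.
    have : P (Imp (Dia p) (Or (Dia q) (Dia q'))).
      by apply: (th_trans thP dqq'); apply: th_KDia.
    by case/(pr_imp_or prP).
  + have th := theory_imp thpr (Imp p q).
    exact: (th_trans th (th_refl thpr _) (th_orl th q q')).
  + have th := theory_imp thpr (Imp p q').
    exact: (th_trans th (th_refl thpr _) (th_orr th q q')).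
- by exists (Imp p Bot), Bot.
- by move=> _ [q nq ->] /(th_box_dia thP).
exists Q; split=> // q pq; apply: contrapT => nq.
by apply: AQ pq; exists q.
Qed.

End Theories.

(** * Semantics and soundness *)

Section Semantics.
Variables (R : realType) (V : Type).

(* The forcing clause for implication on the chain [0,1]: with it, the Kripke
   reading "x <= feval v p" validates the intuitionistic axioms directly. *)
Lemma le_gimp (a b x : R) : x <= 1 ->
  x <= gimp a b <-> forall y, y <= x -> y <= a -> y <= b.
Proof.
rewrite /gimp => x1; case: (leP a b) => [ab|ba]; split=> //.
- by move=> _ y _ ya; apply: le_trans ab.
- by move=> xb y yx _; apply: le_trans xb.
- move=> yb; case: (leP x a) => [|/ltW ax]; first exact: yb.
  by move: ba; rewrite ltNge (yb a).
Qed.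

Lemma gimp_eq1 (a b : R) : a <= 1 -> b <= 1 -> gimp a b = 1 <-> a <= b.
Proof.
rewrite /gimp => a1 b1; case: (leP a b) => // ba; split=> // b_1.
by move: ba; rewrite b_1 ltNge a1.
Qed.

Variable M : model R V.
Implicit Types (v w : world M) (p q : fml V).

Lemma feval_itv v p : 0 <= feval v p <= 1.
Proof.
elim: p v => [x||p IHp q IHq|p IHp q IHq|p IHp q IHq|p IHp|p IHp] v /=.
- exact: val_of_itv.
- by rewrite lexx ler01.
- have /andP[p0 p1] := IHp v; have /andP[q0 q1] := IHq v.
  by rewrite le_min p0 q0 ge_min p1.
- have /andP[p0 p1] := IHp v; have /andP[q0 q1] := IHq v.
  by rewrite le_max p0 ge_max p1 q1.
- by rewrite /gimp; case: ifP => // _; rewrite ler01 lexx.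
- rewrite /ginf; case: asboolP => [_|/eqP/set0P[a Aa]].
    by rewrite ler01 lexx.
  apply/andP; split.
    by apply: lb_le_inf; [exists a|move=> _ [w _ ->]; case/andP: (IHp w)].
  case: (Aa) => w vw aw; have /andP[_ w1] := IHp w.
  apply: (le_trans _ w1); apply: ge_inf; last by exists w.
  by exists 0 => _ [w' _ ->]; case/andP: (IHp w').
- rewrite /gsup; case: asboolP => [_|/eqP/set0P[a Aa]].
    by rewrite ler01 lexx.
  apply/andP; split.
    case: (Aa) => w vw aw; have /andP[w0 _] := IHp w.
    apply: (le_trans w0); apply: ub_le_sup; last by exists w.
    by exists 1 => _ [w' _ ->]; case/andP: (IHp w').
  by apply: ge_sup; [exists a|move=> _ [w _ ->]; case/andP: (IHp w)].
Qed.

Lemma feval_ge0 v p : 0 <= feval v p.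
Proof. by case/andP: (feval_itv v p). Qed.

Lemma feval_le1 v p : feval v p <= 1.
Proof. by case/andP: (feval_itv v p). Qed.

(** The conjunct [x <= 1] accounts for a world without successors; in this form the infimum need not
    be unfolded again. *)
Lemma le_feval_box v p (x : R) :
  x <= feval v (Box p) <-> x <= 1 /\ forall w, acc v w -> x <= feval w p.
Proof.
split=> [xp|[x1 xp]]; last first.
  rewrite /= /ginf; case: asboolP => // /eqP/set0P A0.
  by apply: lb_le_inf => // _ [w vw ->]; apply: xp.
split=> [|w vw]; first exact: le_trans xp (feval_le1 _ _).
apply: (le_trans xp); rewrite /= /ginf; case: asboolP => [A0|_].
  suff : set0 (feval w p) by [].
  by rewrite -A0; exists w.
apply: ge_inf; last by exists w.
by exists 0 => _ [w' _ ->]; apply: feval_ge0.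
Qed.

Lemma feval_dia_le v p (x : R) :
  feval v (Dia p) <= x <-> 0 <= x /\ forall w, acc v w -> feval w p <= x.
Proof.
split=> [px|[x0 px]]; last first.
  rewrite /= /gsup; case: asboolP => // /eqP/set0P A0.
  by apply: ge_sup => // _ [w vw ->]; apply: px.
split=> [|w vw]; first exact: le_trans (feval_ge0 _ _) px.
apply: (le_trans _ px); rewrite /= /gsup; case: asboolP => [A0|_].
  suff : set0 (feval w p) by [].
  by rewrite -A0; exists w.
apply: ub_le_sup; last by exists w.
by exists 1 => _ [w' _ ->]; apply: feval_le1.
Qed.

Lemma feval_box_le v w p : acc v w -> feval v (Box p) <= feval w p.
Proof.
move=> vw.
have [/(_ (lexx _))[_ le_box] _] := le_feval_box v p (feval v (Box p)).
exact: le_box.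
Qed.

Lemma le_feval_dia v w p : acc v w -> feval w p <= feval v (Dia p).
Proof.
move=> vw.
have [/(_ (lexx _))[_ dia_le] _] := feval_dia_le v p (feval v (Dia p)).
exact: dia_le.
Qed.

Lemma feval_imp1 v p q : feval v (Imp p q) = 1 <-> feval v p <= feval v q.
Proof. by apply: gimp_eq1; apply: feval_le1. Qed.

Lemma le_feval_imp v p q (x : R) : x <= 1 ->
  x <= feval v (Imp p q) <->
  forall y, y <= x -> y <= feval v p -> y <= feval v q.
Proof. exact: le_gimp. Qed.

Lemma feval_imp1P v p q :
  (forall x, x <= 1 -> x <= feval v p -> x <= feval v q) ->
  feval v (Imp p q) = 1.
Proof. by move=> pq; apply/feval_imp1/pq => //; apply: feval_le1. Qed.

Lemma le_feval_MP v p q (x : R) :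
  x <= feval v (Imp p q) -> x <= feval v p -> x <= feval v q.
Proof.
move=> xpq; have x1 := le_trans xpq (feval_le1 v _).
exact: (proj1 (le_feval_imp v p q x1) xpq x (lexx x)).
Qed.

Lemma axiom_sound v p : GKc_axiom p -> feval v p = 1.
Proof.
case=> {p}.
- move=> p q; apply: feval_imp1P => x x1 xp.
  by apply/le_feval_imp => // y yx _; exact: le_trans xp.
- move=> p q r; apply: feval_imp1P => x x1 xpqr.
  apply/le_feval_imp => // y yx ypq; have y1 := le_trans yx x1.
  apply/le_feval_imp => // z zy zp.
  apply: (@le_feval_MP _ q); last exact: le_feval_MP (le_trans zy ypq) zp.
  by apply: le_feval_MP zp; apply: le_trans xpqr; apply: le_trans yx.
- by move=> p q; apply/feval_imp1; rewrite /= ge_min lexx.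
- by move=> p q; apply/feval_imp1; rewrite /= ge_min lexx orbT.
- move=> p q; apply: feval_imp1P => x x1 xp.
  by apply/le_feval_imp => // y yx yq; rewrite /= le_min yq (le_trans yx xp).
- by move=> p q; apply/feval_imp1; rewrite /= le_max lexx.
- by move=> p q; apply/feval_imp1; rewrite /= le_max lexx orbT.
- move=> p q r; apply: feval_imp1P => x x1 xpr.
  apply/le_feval_imp => // y yx yqr; have y1 := le_trans yx x1.
  apply/le_feval_imp => // z zy; rewrite /= le_max => /orP[zp|zq].
    by apply: le_feval_MP zp; apply: le_trans xpr; apply: le_trans yx.
  by apply: le_feval_MP zq; apply: le_trans yqr.
- by move=> p; apply/feval_imp1; apply: feval_ge0.
- move=> p q; rewrite -[LHS]/(Num.max (feval v (Imp p q)) (feval v (Imp q p))).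
  have [pq|/ltW qp] := leP (feval v p) (feval v q).
    by rewrite (proj2 (feval_imp1 v p q) pq) max_l // feval_le1.
  by rewrite (proj2 (feval_imp1 v q p) qp) max_r // feval_le1.
- move=> p q; apply: feval_imp1P => x x1 xpq.
  apply/le_feval_imp => // y yx yp; have y1 := le_trans yx x1.
  apply/le_feval_box; split=> // w vw.
  apply: (@le_feval_MP _ p).
    by apply: le_trans (feval_box_le _ vw); apply: le_trans xpq.
  exact: le_trans (feval_box_le _ vw).
- move=> p q; apply/feval_imp1/feval_dia_le; split=> [|w vw].
    exact: feval_ge0 v (Or (Dia p) (Dia q)).
  rewrite -[leRHS]/(Num.max (feval v (Dia p)) (feval v (Dia q))).
  rewrite [leLHS]/= ge_max !le_max; apply/andP; split; apply/orP.
    by left; apply: le_feval_dia.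
  by right; apply: le_feval_dia.
- move=> p q; apply/feval_imp1/feval_dia_le; split=> [|w vw].
    exact: feval_ge0.
  apply/le_feval_imp => [|y ypq yp]; first exact: feval_le1.
  apply: le_trans (le_feval_dia _ vw); apply: le_feval_MP ypq _.
  exact: le_trans yp (feval_box_le _ vw).
- move=> p q; apply/feval_imp1/le_feval_box; split=> [|w vw].
    exact: feval_le1.
  apply/le_feval_imp => [|y ypq yp]; first exact: feval_le1.
  apply: le_trans (feval_box_le _ vw); apply: le_feval_MP ypq _.
  exact: le_trans yp (le_feval_dia _ vw).
- by apply/feval_imp1/feval_dia_le; split=> [|w vw]; apply: lexx.
- move=> p q; apply: feval_imp1P => x x1 xpq.
  rewrite -[leRHS]/(Num.max (feval v (Box p)) (feval v (Dia q))) le_max.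
  (* If [Dia q] stays below [x], so does [q] at every successor, and the disjunction must reach [x]
     through [p]. *)
  apply/orP; case: (leP x (feval v (Dia q))) => [|qx]; [by right|left].
  apply/le_feval_box; split=> // w vw.
  have := le_trans xpq (feval_box_le _ vw); rewrite /= le_max => /orP[//|xq].
  have := le_trans xq (le_feval_dia _ vw).
  by rewrite leNgt qx.
Qed.

(** Premises are assumed true at all worlds; for the modal rules [G] is empty, so the induction
    hypothesis holds outright at every successor. *)
Lemma derives_sound (G : set (fml V)) p : derives G p ->
  (forall q v, G q -> feval v q = 1) -> forall v, feval v p = 1.
Proof.
elim=> {G p}.
- by move=> G p Gp Gtrue v; apply: Gtrue.
- by move=> G p ax _ v; apply: axiom_sound.
- move=> G p q _ IHpq _ IHp Gtrue v; apply/le_anti; rewrite feval_le1 /=.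
  by rewrite -{1}(IHp Gtrue v); apply/feval_imp1/IHpq.
- move=> G p _ IHp _ v; apply/le_anti; rewrite feval_le1 /=.
  by apply/le_feval_box; split=> // w _; rewrite IHp.
- move=> G p q _ IHpq _ v; apply/feval_imp1/feval_dia_le.
  split=> [|w vw]; first exact: feval_ge0.
  by apply: le_trans (le_feval_dia _ vw); apply/feval_imp1/IHpq.
Qed.

End Semantics.

Lemma provable_valid (R : realType) (V : Type) (p : fml V) :
  provable p -> valid R p.
Proof. by move=> pp M; apply: (derives_sound pp). Qed.

(** * Finite maxima, counting and convex combinations *)

Lemma seq_argmax (T : eqType) (R : realType) (s : seq T) (A : T -> Prop)
    (f : T -> R) :
  (exists2 x, x \in s & A x) ->
  exists x, [/\ x \in s, A x & forall y, y \in s -> A y -> f y <= f x].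
Proof.
elim: s => [[]//|z s IHs] exA.
have [/IHs[x [xs Ax fx]]|nos] := pselect (exists2 x, x \in s & A x).
  have [Az|nAz] := pselect (A z); last first.
    exists x; split=> // [|y]; first by rewrite inE xs orbT.
    by rewrite inE => /orP[/eqP->//|]; apply: fx.
  case: (leP (f z) (f x)) => [zx|/ltW xz].
    exists x; split=> // [|y]; first by rewrite inE xs orbT.
    by rewrite inE => /orP[/eqP->//|]; apply: fx.
  exists z; split=> // [|y]; first by rewrite inE eqxx.
  by rewrite inE => /orP[/eqP->//|ys Ay]; apply: le_trans xz; apply: fx.
have noA y : y \in s -> ~ A y by move=> ys Ay; apply: nos; exists y.
case: exA => x; rewrite inE => /orP[/eqP-> Az|/noA//].
exists z; split=> // [|y]; first by rewrite inE eqxx.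
by rewrite inE => /orP[/eqP->//|/noA].
Qed.

Lemma count_ltn (T : eqType) (a b : pred T) (s : seq T) (x : T) :
  subpred a b -> x \in s -> b x -> ~~ a x -> (count a s < count b s)%N.
Proof.
move=> ab xs bx nax.
have -> : count b s = (count a s + count (predD b a) s)%N.
  rewrite -count_predUI (@eq_count _ (predI _ _) pred0) ?count_pred0 ?addn0.
    by apply: eq_count => y /=; case: (boolP (a y)) => // /ab.
  by move=> y /=; case: (a y).
rewrite -[ltnLHS]addn0 ltn_add2l -has_count; apply/hasP.
by exists x; rewrite //= nax.
Qed.

(** The difference of the two sides is the sum of the three nonnegative products below. *)
Lemma convex_comb_le (R : realFieldType) (l u l' u' t t' : R) :
  l <= l' -> u <= u' -> l' <= u' -> 0 <= t -> t <= t' -> t' <= 1 ->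
  l + t * (u - l) <= l' + t' * (u' - l').
Proof.
move=> ll uu lu t0 tt t1.
have h1 : 0 <= (1 - t) * (l' - l) by apply: mulr_ge0; lra.
have h2 : 0 <= t * (u' - u) by apply: mulr_ge0; lra.
have h3 : 0 <= (t' - t) * (u' - l') by apply: mulr_ge0; lra.
lra.
Qed.

Lemma convex_comb_lt (R : realFieldType) (l u l' u' t t' : R) :
  l <= l' -> u <= u' -> l' <= u' -> l < u' -> 0 <= t -> t < t' -> t' <= 1 ->
  l + t * (u - l) < l' + t' * (u' - l').
Proof.
move=> ll uu lu lu' t0 tt t1.
have h1 : 0 <= (1 - t) * (l' - l) by apply: mulr_ge0; lra.
have h2 : 0 <= t * (u' - u) by apply: mulr_ge0; lra.
(* When [l' = u'] the third product vanishes, and strictness comes from [l < u'] and [t < 1]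
   instead. *)
move: lu; rewrite le_eqVlt => /orP[/eqP e|lu].
  have h3 : 0 < (1 - t) * (u' - l) by apply: mulr_gt0; lra.
  by rewrite e; lra.
have h3 : 0 < (t' - t) * (u' - l') by apply: mulr_gt0; lra.
lra.
Qed.

Local Notation Top := (Imp Bot Bot).

(** * Realising the chain of a prime theory in [0,1] *)

Section Valuations.
Variables (R : realType) (V : Type).
Implicit Types (S : seq (fml V)) (P Q : set (fml V)) (p q : fml V).
Implicit Types (h g l u : fml V -> R).

(** Only the order of [P] is recorded; membership of [p] in [P] is recovered as [Imp Top p]. *)
Record fits S P h : Prop := Fits {
  fits_itv : forall p, 0 <= h p <= 1;
  fits_bot : h Bot = 0;
  fits_top : h Top = 1;
  fits_le : forall p q, p \in S -> q \in S -> P (Imp p q) <-> h p <= h q }.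

(** Each formula is put at a fraction of its interval that grows with its rank. Monotone endpoints
    preserve the order, and [l p < u q] with distinct ranks keeps it strict even when intervals
    overlap or degenerate. *)
Lemma fits_between S P l u (lo hi : R) :
    prime P -> 0 <= lo -> lo < hi -> hi <= 1 ->
    (forall p, [/\ 0 <= l p, l p <= u p & u p <= 1]) ->
    (forall p q, P (Imp p q) -> l p <= l q /\ u p <= u q) ->
    (forall p q, ~ P (Imp q p) -> l p < u q) ->
    l Top = 1 -> u Bot = 0 ->
  exists2 g, fits S P g &
    forall p, l p <= g p <= u p /\
      exists2 t, lo < t < hi & g p = l p + t * (u p - l p).
Proof.
move=> prP lo0 lohi hi1 lu mono strict lTop uBot; have thP := pr_theory prP.
(* The rank counts the members of [S] strictly below [p]; the shift by 2 in [t] keeps the fraction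
   strictly above [lo] even at rank 0. *)
pose rank p := count (fun q => `[< ~ P (Imp p q) >]) S.
pose t n : R := lo + (hi - lo) * (1 - n.+2%:R^-1).
have hl0 : 0 < hi - lo by rewrite subr_gt0.
have tlt n m : (n < m)%N -> t n < t m.
  move=> nm; rewrite ltrD2l ltr_pM2l // ltrD2l ltrN2 ltf_pV2 ?posrE ?ltr0n //.
  by rewrite ltr_nat.
have tle n m : (n <= m)%N -> t n <= t m.
  by rewrite leq_eqVlt => /orP[/eqP->//|/tlt/ltW].
have t_itv n : lo < t n < hi.
  have n1 : (n.+2%:R^-1 : R) < 1 by rewrite invf_lt1 ?ltr0n // ltr1n.
  have n0 : 0 < (n.+2%:R^-1 : R) by rewrite invr_gt0 ltr0n.
  move: n0 n1; set c := _^-1 => n0 n1.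
  have h0 : 0 < (hi - lo) * (1 - c) by apply: mulr_gt0; lra.
  have h1 : 0 < (hi - lo) * c by apply: mulr_gt0; lra.
  by rewrite /t -/c; apply/andP; split; lra.
pose g p := l p + t (rank p) * (u p - l p).
have g_lu p : l p <= g p <= u p.
  have [l0 lup u1] := lu p; have /andP[t0 t1] := t_itv (rank p).
  have h0 : 0 <= t (rank p) * (u p - l p) by apply: mulr_ge0; lra.
  have h1 : 0 <= (1 - t (rank p)) * (u p - l p) by apply: mulr_ge0; lra.
  by rewrite /g; apply/andP; split; lra.
have rank_le p q : P (Imp p q) -> (rank p <= rank q)%N.
  move=> pq; apply: sub_count => r /asboolP nr; apply/asboolP => qr.
  by apply: nr; apply: th_trans pq qr.
have rank_lt p q : p \in S -> ~ P (Imp q p) -> (rank p < rank q)%N.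
  (* The formula [p] itself is counted for [q] but not for [p]. *)
  move=> pS nqp; apply: (count_ltn _ pS); last 2 first.
  - exact/asboolP.
  - by apply/asboolPn => /(_ (th_refl thP p)).
  move=> r /asboolP nr; apply/asboolP => qr.
  by apply: nr; apply: th_trans qr => //; apply: pr_notimp.
exists g; last by move=> p; split=> //; exists (t (rank p)).
split=> [p|||p q pS qS].
- have [l0 _ u1] := lu p; have /andP[lg gu] := g_lu p.
  by rewrite (le_trans l0) // (le_trans gu).
- have [l0 _ _] := lu Bot; have /andP[lg gu] := g_lu Bot.
  by apply/le_anti; rewrite -{1}uBot gu (le_trans l0).
- have [_ _ u1] := lu Top; have /andP[lg gu] := g_lu Top.
  by apply/le_anti; rewrite -{2}lTop lg (le_trans gu).
have /andP[tp0 tp1] := t_itv (rank p); have /andP[tq0 tq1] := t_itv (rank q).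
have [_ luq _] := lu q; have [_ lup _] := lu p.
split=> [pq|gpq].
  have [lpq upq] := mono _ _ pq; have tpq := tle _ _ (rank_le _ _ pq).
  by apply: convex_comb_le => //; lra.
apply: contrapT => npq; move: gpq; apply/negP; rewrite -ltNge.
have [lqp uqp] := mono _ _ (pr_notimp prP npq).
have tqp := tlt _ _ (rank_lt _ _ qS npq); have lqup := strict _ _ npq.
by apply: convex_comb_lt => //; lra.
Qed.

(** No predecessor constrains this valuation: the interval is the point 1 on [P], the point 0 on
    formulas refuted by [P], and all of [0,1] elsewhere. *)
Lemma prime_fits S P : prime P -> exists h, fits S P h.
Proof.
move=> prP; have thP := pr_theory prP.
pose l p : R := if `[< P p >] then 1 else 0.
pose u p : R := if `[< P (Imp p Bot) >] then 0 else 1.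
have contra p : P p -> P (Imp p Bot) -> False.
  by move=> Pp /(th_mp thP) /(_ Pp) /(pr_bot prP).
have [| | | | | | | |h fh _] := @fits_between S P l u 0 1 prP => //.
- by move=> p; rewrite /l /u; do 2 case: asboolP; split=> //; exfalso; eauto.
- move=> p q pq; rewrite /l /u; split.
    by do 2 case: asboolP => //; move=> nq /(th_mp thP pq).
  case: (asboolP (P (Imp q Bot))) => [qB|_]; last by case: ifP.
  by rewrite asboolT //; apply: th_trans pq qB.
- move=> p q nqp; rewrite /l /u; case: asboolP => [Pp|_].
    by case: nqp; apply: th_const.
  case: asboolP => // nq; case: nqp.
  by apply: (th_trans thP nq); apply: th_bot.
- by rewrite /l asboolT //; apply: th_refl.
- by rewrite /u asboolT //; apply: th_refl.
by exists h.
Qed.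

Lemma fits_ge0 S P h p : fits S P h -> 0 <= h p.
Proof. by case/fits_itv/(_ p)/andP. Qed.

Lemma fits_le1 S P h p : fits S P h -> h p <= 1.
Proof. by case/fits_itv/(_ p)/andP. Qed.

(** * Finite sets closed under subformulas *)

Definition immediate_subs p : seq (fml V) :=
  match p with
  | Var _ | Bot => [::]
  | And q r | Or q r | Imp q r => [:: q; r]
  | Box q | Dia q => [:: q]
  end.

Fixpoint subs p : seq (fml V) :=
  p :: match p with
       | Var _ | Bot => [::]
       | And q r | Or q r | Imp q r => subs q ++ subs r
       | Box q | Dia q => subs q
       end.

Definition sub_closed S :=
  forall p q, p \in S -> q \in immediate_subs p -> q \in S.

Lemma subs_refl p : p \in subs p.
Proof. by case: p => *; apply: mem_head. Qed.

Lemma subs_closed p : sub_closed (subs p).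
Proof.
elim: p => [x||p IHp q IHq|p IHp q IHq|p IHp q IHq|p IHp|p IHp] r s /=.
- by rewrite inE => /eqP->.
- by rewrite inE => /eqP->.
1,2,3: rewrite in_cons mem_cat => /or3P[/eqP->|/IHp sub /sub|/IHq sub /sub];
  rewrite !(in_cons, mem_cat, in_nil) ?orbF /=;
  by [case/orP=> /eqP->; rewrite subs_refl !orbT | move=> ->; rewrite !orbT].
1,2: rewrite in_cons => /orP[/eqP->|/IHp sub /sub];
  rewrite !(in_cons, in_nil) ?orbF /=;
  by [move/eqP->; rewrite subs_refl !orbT | move=> ->; rewrite !orbT].
Qed.

(* The four modal formulas make the maximum l p and the minimum u p range over
   nonempty sets, and force l Top = 1 and u Bot = 0. *)
Record adequate S : Prop := Adequate {
  ad_sub : sub_closed S;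
  ad_boxTop : Box Top \in S;
  ad_boxBot : Box Bot \in S;
  ad_diaTop : Dia Top \in S;
  ad_diaBot : Dia Bot \in S }.

Lemma adequate_exists p : exists2 S, adequate S & p \in S.
Proof.
(* Conjoining the four modal formulas to [p] puts them all among the subformulas of one formula. *)
pose r := And p (And (And (Box Top) (Box Bot)) (And (Dia Top) (Dia Bot))).
exists (subs r); last first.
  by apply: (subs_closed (subs_refl r)); rewrite !inE eqxx.
have cl := @subs_closed r.
have h1 := cl _ (And (And (Box Top) (Box Bot)) (And (Dia Top) (Dia Bot)))
  (subs_refl r) ltac:(by rewrite !inE eqxx ?orbT).
have h2 := cl _ (And (Box Top) (Box Bot)) h1 ltac:(by rewrite !inE eqxx ?orbT).
have h3 := cl _ (And (Dia Top) (Dia Bot)) h1 ltac:(by rewrite !inE eqxx ?orbT).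
by split=> //; [apply: cl h2 _|apply: cl h2 _|apply: cl h3 _|apply: cl h3 _];
  rewrite !inE eqxx ?orbT.
Qed.

(** The last clause exposes the endpoints attained at [a] and [b], so that a suitable choice of [lo]
    and [hi] drives [g p] towards either of them. *)
Lemma fits_successor S P Q h (lo hi : R) :
    adequate S -> prime P -> fits S P h -> prime Q ->
    (forall p, P (Box p) -> Q p) -> (forall p, Q p -> P (Dia p)) ->
    0 <= lo -> lo < hi -> hi <= 1 ->
  exists g, [/\ fits S Q g,
    forall p, Box p \in S -> h (Box p) <= g p,
    forall p, Dia p \in S -> g p <= h (Dia p) &
    forall p, exists t a b, [/\ lo < t < hi, Box a \in S /\ Q (Imp a p),
      Dia b \in S /\ Q (Imp p b) &
      g p = h (Box a) + t * (h (Dia b) - h (Box a))]].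
Proof.
move=> adS prP fh prQ PQ QP lo0 lohi hi1.
have thP := pr_theory prP; have thQ := pr_theory prQ.
have subS := ad_sub adS.
have boxS p : Box p \in S -> p \in S by move/subS; apply; rewrite inE.
have diaS p : Dia p \in S -> p \in S by move/subS; apply; rewrite inE.
have hle := fits_le fh.
have /choice[lo_ lo_P] : forall p, exists a,
    [/\ a \in S, Box a \in S /\ Q (Imp a p) &
      forall b, b \in S -> Box b \in S /\ Q (Imp b p) ->
        h (Box b) <= h (Box a)].
  move=> p.
  apply: (seq_argmax (A := fun a => Box a \in S /\ Q (Imp a p))
    (fun a => h (Box a))).
  exists Bot; first exact/boxS/ad_boxBot.
  by split; [apply: ad_boxBot|apply: th_bot].
(* The minimum over diamonds is obtained as a maximum of opposites. *)
have /choice[up upP] : forall p, exists b,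
    [/\ b \in S, Dia b \in S /\ Q (Imp p b) &
      forall a, a \in S -> Dia a \in S /\ Q (Imp p a) ->
        - h (Dia a) <= - h (Dia b)].
  move=> p.
  apply: (seq_argmax (A := fun b => Dia b \in S /\ Q (Imp p b))
    (fun b => - h (Dia b))).
  exists Top; first exact/diaS/ad_diaTop.
  by split; [apply: ad_diaTop|apply: th_const => //; apply: th_refl].
pose l p := h (Box (lo_ p)); pose u p := h (Dia (up p)).
have le_l p a : Box a \in S -> Q (Imp a p) -> h (Box a) <= l p.
  by move=> aS ap; have [_ _] := lo_P p; apply=> //; apply: boxS.
have u_le p b : Dia b \in S -> Q (Imp p b) -> u p <= h (Dia b).
  move=> bS pb; rewrite -lerN2; have [_ _] := upP p; apply=> //; exact: diaS.
have [| | | | |g fg gt] := @fits_between S Q l u lo hi prQ lo0 lohi hi1.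
(* With [a], [p], [b] increasing in [Q], the formula [Dia (Imp a b)] is in [P], and FS1 turns it
   into [Imp (Box a) (Dia b)]. *)
- move=> p; rewrite (fits_ge0 _ fh) (fits_le1 _ fh); split=> //.
  have [_ [lS lp] _] := lo_P p; have [_ [uS pu] _] := upP p.
  by apply/hle => //; apply: th_FS1 => //; apply: QP; apply: th_trans pu.
- move=> p q pq; have [_ [lS lp] _] := lo_P p; have [_ [uS qu] _] := upP q.
  by split; [apply: le_l lS _|apply: u_le uS _];
    [apply: th_trans lp pq|apply: th_trans pq qu].
(* Otherwise [Imp (Dia b) (Box a)] is in [P], FS2 puts [Imp b a] in [Q], and [q] falls below [p]
   there. *)
- move=> p q nqp; have [_ [lS lp] _] := lo_P p; have [_ [uS qu] _] := upP q.
  rewrite ltNge; apply/negP => /(hle _ _ uS lS) ul.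
  apply: nqp; apply: (th_trans thQ qu); apply: (th_trans thQ _ lp).
  by apply: PQ; apply: th_FS2.
- apply/le_anti; rewrite (fits_le1 _ fh) /=.
  apply: (@le_trans _ _ (h (Box Top))); last first.
    by apply: le_l; [apply: ad_boxTop|apply: th_refl].
  rewrite -(fits_top fh); apply/hle; first exact/boxS/ad_boxTop.
    exact: ad_boxTop.
  by apply: th_const => //; apply: th_BoxTop.
- apply/le_anti; rewrite (fits_ge0 _ fh) andbT.
  apply: (@le_trans _ _ (h (Dia Bot))).
    by apply: u_le; [apply: ad_diaBot|apply: th_refl].
  rewrite -(fits_bot fh); apply/hle; first exact: ad_diaBot.
    exact/boxS/ad_boxBot.
  exact: th_DiaBot.
have lu p : l p <= g p <= u p by case: (gt p).
exists g; split=> // [p pS|p pS|p].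
- have /andP[+ _] := lu p; apply: le_trans.
  by apply: le_l => //; apply: th_refl.
- have /andP[_ gu] := lu p; apply: (le_trans gu).
  by apply: u_le => //; apply: th_refl.
- have [_ [t tI gE]] := gt p; exists t, (lo_ p), (up p).
  by have [] := lo_P p; have [] := upP p.
Qed.

End Valuations.

(** * The canonical model and the truth lemma *)

Section CanonicalModel.
Variables (R : realType) (V : Type) (S : seq (fml V)).
Hypothesis adS : adequate S.

Definition canonical_world :=
  {h : fml V -> R | exists2 P, prime P & fits S P h}.

Lemma canonical_itv (h : canonical_world) p : 0 <= sval h p <= 1.
Proof. by case: h => h [P prP fh]; apply: (fits_itv fh). Qed.

Definition canonical_model (h0 : canonical_world) : model R V := {|
  world := canonical_world;
  world_inhabited := inhabits h0;
  acc := fun h g =>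
    (forall p, Box p \in S -> sval h (Box p) <= sval g p) /\
    (forall p, Dia p \in S -> sval g p <= sval h (Dia p));
  val_of := fun h x => sval h (Var x);
  val_of_itv := fun h x => canonical_itv h (Var x) |}.

Variable h0 : canonical_world.
Local Notation M := (canonical_model h0).

(** Fractions are taken in the open interval from 0 to [eta]: the lower endpoint is at most the
    value of [Box p], and an interval has length at most 1. *)
Lemma canonical_box (h : world M) p (eta : R) : Box p \in S ->
    sval h (Box p) < 1 -> 0 < eta -> eta <= 1 ->
  exists2 g : world M, acc h g & sval g p < sval h (Box p) + eta.
Proof.
case: h => h [P prP fh] /= pS hp1 eta0 eta1.
have boxTopS := ad_boxTop adS.
have topS : Top \in S by apply: (ad_sub adS boxTopS); rewrite inE.
have thP := pr_theory prP.
have [|Q [prQ PQ QP Qp]] := @prime_box_successor _ P p prP.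
  move=> Pp; move: hp1; apply/negP; rewrite -leNgt -(fits_top fh).
  by apply/(fits_le fh) => //; apply: th_const.
have [g [fg hg gh gE]] :=
  fits_successor adS prP fh prQ PQ QP (lexx 0) eta0 eta1.
exists (exist _ g (ex_intro2 _ _ Q prQ fg)) => //=.
have [t [a [b [/andP[t0 teta] [aS /Qp ap] _ ->]]]] := gE p.
have ha : h (Box a) <= h (Box p) by apply/(fits_le fh).
have := fits_ge0 (Box a) fh; have := fits_le1 (Dia b) fh => b1 a0.
have : 0 <= t * (1 - (h (Dia b) - h (Box a))) by apply: mulr_ge0; lra.
lra.
Qed.

Lemma canonical_dia (h : world M) p (eta : R) : Dia p \in S ->
    0 < sval h (Dia p) -> 0 < eta -> eta <= 1 ->
  exists2 g : world M, acc h g & sval h (Dia p) - eta < sval g p.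
Proof.
case: h => h [P prP fh] /= pS hp0 eta0 eta1.
have diaBotS := ad_diaBot adS.
have botS : Bot \in S by apply: (ad_sub adS diaBotS); rewrite inE.
have thP := pr_theory prP.
have [|Q [prQ PQ QP Qp]] := @prime_dia_successor _ P p prP.
  move=> Pp; move: hp0; apply/negP; rewrite -leNgt -(fits_bot fh).
  by apply/(fits_le fh) => //; apply: (th_trans thP Pp); apply: th_DiaBot.
(* Dually, fractions between [1 - eta] and 1 push [g p] towards its upper endpoint, which is at
   least the value of [Dia p]. *)
have lo0 : 0 <= 1 - eta by lra.
have lo1 : 1 - eta < 1 by lra.
have [g [fg hg gh gE]] := fits_successor adS prP fh prQ PQ QP lo0 lo1 (lexx 1).
exists (exist _ g (ex_intro2 _ _ Q prQ fg)) => //=.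
have [t [a [b [/andP[t0 t1] _ [bS /Qp pb] ->]]]] := gE p.
have hb : h (Dia p) <= h (Dia b) by apply/(fits_le fh).
have := fits_ge0 (Box a) fh; have := fits_le1 (Dia b) fh => b1 a0.
have : 0 <= (1 - t) * (1 - (h (Dia b) - h (Box a))) by apply: mulr_ge0; lra.
lra.
Qed.

Lemma truth_lemma p (h : world M) : p \in S -> feval h p = sval h p.
Proof.
elim: p h => [x||p IHp q IHq|p IHp q IHq|p IHp q IHq|p IHp|p IHp] h pS.
- by [].
- by case: h => h [P prP fh]; rewrite /= (fits_bot fh).
- have pS' : p \in S by apply: (ad_sub adS pS); rewrite !inE eqxx.
  have qS : q \in S by apply: (ad_sub adS pS); rewrite !inE eqxx orbT.
  rewrite [LHS]/= IHp // IHq //; case: h => h [P prP fh] /=.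
  have thP := pr_theory prP.
  have hp : h (And p q) <= h p by apply/(fits_le fh) => //; apply: th_andl.
  have hq : h (And p q) <= h q by apply/(fits_le fh) => //; apply: th_andr.
  apply/le_anti/andP; split; last by rewrite le_min hp.
  rewrite ge_min; apply/orP; case: (pr_total prP p q) => [pq|qp]; [left|right];
    by apply/(fits_le fh) => //; apply: th_imp_and => //; apply: th_refl.
- have pS' : p \in S by apply: (ad_sub adS pS); rewrite !inE eqxx.
  have qS : q \in S by apply: (ad_sub adS pS); rewrite !inE eqxx orbT.
  rewrite [LHS]/= IHp // IHq //; case: h => h [P prP fh] /=.
  have thP := pr_theory prP.
  have hp : h p <= h (Or p q) by apply/(fits_le fh) => //; apply: th_orl.
  have hq : h q <= h (Or p q) by apply/(fits_le fh) => //; apply: th_orr.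
  apply/le_anti/andP; split; first by rewrite ge_max hp.
  rewrite le_max; apply/orP; case: (pr_total prP p q) => [pq|qp]; [right|left];
    by apply/(fits_le fh) => //; apply: th_or_imp => //; apply: th_refl.
- have pS' : p \in S by apply: (ad_sub adS pS); rewrite !inE eqxx.
  have qS : q \in S by apply: (ad_sub adS pS); rewrite !inE eqxx orbT.
  rewrite [LHS]/= IHp // IHq //; case: h => h [P prP fh] /=.
  have thP := pr_theory prP.
  have topS : Top \in S by apply: (ad_sub adS (ad_boxTop adS)); rewrite inE.
  rewrite /gimp; case: ifPn => [pq|npq].
    apply/le_anti; rewrite (fits_le1 _ fh) andbT -(fits_top fh).
    by apply/(fits_le fh) => //; apply: th_const => //; apply/(fits_le fh).
  apply/le_anti/andP; split.
    by apply/(fits_le fh) => //; apply: (th_ax thP); constructor.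
  apply/(fits_le fh) => //.
  apply: pr_imp_collapse => // /(fits_le fh pS' qS) pq.
  by move: npq; rewrite pq.
- have pS' : p \in S by apply: (ad_sub adS pS); rewrite inE.
  have /andP[hp0 hp1] := canonical_itv h (Box p).
  have le : sval h (Box p) <= feval h (Box p).
    by apply/le_feval_box; split=> // g [hg _]; rewrite IHp //; apply: hg.
  apply/le_anti; rewrite le andbT leNgt; apply/negP => lt.
  have f1 := feval_le1 h (Box p).
  (* Taking the supposed gap as [eta] yields a successor where [p] is below the infimum. *)
  have [| | |g hg] := @canonical_box h p (feval h (Box p) - sval h (Box p)) pS.
  + exact: lt_le_trans lt f1.
  + by rewrite subr_gt0.
  + lra.
  by rewrite addrC subrK -IHp // ltNge feval_box_le.
- have pS' : p \in S by apply: (ad_sub adS pS); rewrite inE.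
  have /andP[hp0 hp1] := canonical_itv h (Dia p).
  have le : feval h (Dia p) <= sval h (Dia p).
    by apply/feval_dia_le; split=> // g [_ gh]; rewrite IHp //; apply: gh.
  apply/le_anti; rewrite le /= leNgt; apply/negP => lt.
  have f0 := feval_ge0 h (Dia p).
  have [| | |g hg] := @canonical_dia h p (sval h (Dia p) - feval h (Dia p)) pS.
  + exact: le_lt_trans f0 lt.
  + by rewrite subr_gt0.
  + lra.
  by rewrite subKr -IHp // ltNge le_feval_dia.
Qed.

End CanonicalModel.

(** * Soundness and completeness combined *)

Theorem theorem4 (R : realType) (V : countType) (phi : fml V) :
  provable phi <-> valid R phi.
Proof.
split; first exact: provable_valid.
move=> val; apply: contrapT => nphi.
have thpr := @provable_theory V.
have [| | |P [prP _ nP]] := @prime_extension _ _ [set phi] thpr.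
- by move=> _ _ -> ->; exists phi; split=> //; apply: th_refl.
- by exists phi.
- by move=> _ ->.
have [S adS phiS] := adequate_exists phi.
have [h fh] := prime_fits R S prP.
pose h0 : canonical_world R S := exist _ h (ex_intro2 _ _ P prP fh).
(* Validity gives [phi] the value of [Top] at [h0], hence puts it in [P], which was chosen to omit
   it. *)
have := val (canonical_model h0) h0; rewrite truth_lemma //= => hphi.
have topS : Top \in S by apply: (ad_sub adS (ad_boxTop adS)); rewrite inE.
apply: (nP phi) => //; have thP := pr_theory prP.
apply: (th_mp thP (p := Top)); last exact: th_refl.
by apply/(fits_le fh) => //; rewrite hphi (fits_top fh).
Qed.
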